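(* Let $n\ge 2$. Every linear Poisson structure $\pi$ on $\mathbb{R}^n$ has a unique decomposition $$\pi=\frac{1}{n-1}\,\hat{I}\wedge\hat{k}+\Lambda,$$ where $k\in\mathbb{R}^n$ is the modular vector of $\pi$ (i.e. $\hat{k}=D(\pi)$) and $\Lambda$ is a linear bivector field with $D(\Lambda)=0$. The bivector field $\Lambda$ is a Poisson structure compatible with $\pi$ if and only if $D(\Lambda\wedge\Lambda)=0$. In particular, when $n=3$, $\Lambda$ is always a unimodular Lie-Poisson structure on $\mathbb{R}^3$.
   Context: Let $\Omega=dx_1\wedge\cdots\wedge dx_n$ on $\mathbb{R}^n$. Let $\Phi$ be the isomorphism from $i$-vector fields to $(n-i)$-forms induced by $\Omega$, $\Phi(X_1\wedge\cdots\wedge X_i)=\Omega(X_1,\dots,X_i,\cdot,\dots,\cdot)$. Define $D=(-1)^{k+1}\Phi^{-1}\circ d\circ\Phi$ from $k$-vector fields to $(k-1)$-vector fields. Then the Schouten bracket satisfies $[U,V]=D(U\wedge V)-D(U)\wedge V-(-1)^iU\wedge D(V)$ for $U$ an $i$-vector field and $V$ any multivector field, and $D(X)=\mathrm{div}_\Omega X$ for a vector field $X$. A linear Poisson structure (also called a Lie-Poisson structure) is a bivector field $\pi$ with coefficients that are homogeneous linear functions and $[\pi,\pi]=0$. Its modular vector field is $D(\pi)$, which is a constant vector field. For a matrix $A=(a_{ij})$, $\hat{A}=\sum_{i,j}a_{ij}x_j\frac{\partial}{\partial x_i}$; in particular $\hat I=\sum_i x_i\frac{\partial}{\partial x_i}$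 with $I$ the identity matrix. For $k\in\mathbb{R}^n$, $\hat{k}=\sum_i k_i\frac{\partial}{\partial x_i}$ is the corresponding constant vector field; $k$ is called the modular vector of $\pi$ if $\hat{k}=D(\pi)$. A Poisson structure $\pi$ is unimodular if $D(\pi)=0$. Two Poisson structures $\pi_1,\pi_2$ are compatible if $[\pi_1,\pi_2]=0$. *)

(* Defs.v *)
From HB Require Import structures.
From mathcomp Require Import all_boot all_order all_algebra.
From mathcomp Require Import all_classical all_reals all_analysis.
Set Implicit Arguments.
Unset Strict Implicit.
Unset Printing Implicit Defensive.
Import Order.TTheory GRing.Theory Num.Theory numFieldNormedType.Exports.
Local Open Scope ring_scope.

Section Multivectors.
Variables (R : realType) (n : nat).

Definition fctn := 'rV[R]_n -> R.

Definition pderiv (j : 'I_n) (f : fctn) : fctn :=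
  fun x => 'D_(delta_mx 0 j) f x.

(* C^oo: every iterated partial derivative (including f itself) is
   differentiable everywhere. *)
Definition smooth (f : fctn) : Prop :=
  forall (s : seq 'I_n) (x : 'rV[R]_n), differentiable (foldr pderiv f s) x.

(* A multivector field sum_I U_I d/dx_I is given by its coefficients U_I, where
   d/dx_I = d/dx_{i1} /\ ... /\ d/dx_{ik} for I = {i1 < ... < ik}; a differential
   form is given in the same way by its coefficients on the dx_I. All degrees
   are allowed at once, the k-vector fields being singled out by [kvector]. *)
Definition mvfield := {set 'I_n} -> fctn.
Definition dform := {set 'I_n} -> fctn.

Definition kvector (k : nat) (U : mvfield) : Prop :=
  (forall I : {set 'I_n}, #|I| != k -> U I = 0) /\ (forall I, smooth (U I)).

(* For disjoint I and J, d/dx_I /\ d/dx_J = shuffle_sign I J d/dx_(I :|: J). *)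
Definition shuffle_sign (I J : {set 'I_n}) : R :=
  (-1) ^+ #|[set p : 'I_n * 'I_n | [&& p.1 \in I, p.2 \in J & (p.2 < p.1)%N]]|.

Definition wedge (U V : {set 'I_n} -> fctn) : {set 'I_n} -> fctn :=
  fun K x => \sum_(I : {set 'I_n} | I \subset K)
    shuffle_sign I (K :\: I) * U I x * V (K :\: I) x.

Definition mpderiv (j : 'I_n) (U : {set 'I_n} -> fctn) : {set 'I_n} -> fctn :=
  fun I => pderiv j (U I).

Definition ext_d (w : dform) : dform :=
  \sum_(j < n) wedge (fun J _ => (J == [set j])%:R) (mpderiv j w).

(* w(X_1, ..., X_i, ., ..., .) for U = X_1 /\ ... /\ X_i, extended linearly. *)
Definition contract (U : mvfield) (w : dform) : dform :=
  fun J x => \sum_(I : {set 'I_n} | [disjoint I & J])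
    shuffle_sign I J * U I x * w (I :|: J) x.

Definition volume_form : dform := fun J _ => (J == [set: 'I_n])%:R.

Definition Phi (U : mvfield) : dform := contract U volume_form.

Definition Phi_inv (w : dform) : mvfield :=
  fun I x => shuffle_sign I (~: I) * w (~: I) x.

Lemma PhiE (U : mvfield) (J : {set 'I_n}) (x : 'rV[R]_n) :
  Phi U J x = shuffle_sign (~: J) J * U (~: J) x.
Proof.
rewrite /Phi /contract /volume_form (bigD1 (~: J)) /=; last first.
  by rewrite finset.disjoints_subset.
rewrite finset.setUC finset.setUCr eqxx mulr1 big1 ?addr0 // => I /andP[dIJ nIJ].
case: eqP => [IJ|_]; last by rewrite mulr0.
case/eqP: nIJ; apply/eqP; rewrite finset.eqEsubset -finset.disjoints_subset dIJ /=.
apply/fintype.subsetP => i; rewrite finset.in_setC; have := finset.in_setT i.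
by rewrite -IJ finset.in_setU => /orP[->//|->].
Qed.

Lemma PhiK : cancel Phi Phi_inv.
Proof.
move=> U; apply/funext => I; apply/funext => x.
by rewrite /Phi_inv PhiE finset.setCK mulrA -expr2 sqrr_sign mul1r.
Qed.

Lemma Phi_invK : cancel Phi_inv Phi.
Proof.
move=> w; apply/funext => J; apply/funext => x.
by rewrite PhiE /Phi_inv finset.setCK mulrA -expr2 sqrr_sign mul1r.
Qed.

Definition D (k : nat) (U : mvfield) : mvfield :=
  (-1) ^+ k.+1 *: Phi_inv (ext_d (Phi U)).

(* Left interior product of a multivector field with dx_j. *)
Definition interior (j : 'I_n) (U : mvfield) : mvfield :=
  fun I x => if j \in I then 0 else shuffle_sign [set j] I * U (j |: I) x.

(* Schouten bracket [U, V] of an i-vector field U with a multivector field V: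
   the biderivation extending the Lie bracket of vector fields, written in
   coordinates. The sign is the one for which
   [U, V] = D(U /\ V) - D(U) /\ V - (-1)^i U /\ D(V). *)
Definition schouten (i : nat) (U V : mvfield) : mvfield :=
  \sum_(j < n) (wedge (interior j U) (mpderiv j V)
                + (-1) ^+ i *: wedge (mpderiv j U) (interior j V)).

Definition vfield (X : 'I_n -> fctn) : mvfield :=
  fun I x => \sum_(i < n | I == [set i]) X i x.

Definition hat_mx (A : 'M[R]_n) : mvfield :=
  vfield (fun i x => \sum_(j < n) A i j * x 0 j).

Definition hat_vec (k : 'rV[R]_n) : mvfield := vfield (fun i _ => k 0 i).

Definition linear_coef (U : mvfield) : Prop := forall I, scalar (U I).

Definition linear_bivector (U : mvfield) : Prop := kvector 2 U /\ linear_coef U.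

Definition poisson (P : mvfield) : Prop := kvector 2 P /\ schouten 2 P P = 0.

Definition linear_poisson (P : mvfield) : Prop := poisson P /\ linear_coef P.

Definition unimodular (P : mvfield) : Prop := D 2 P = 0.

Definition compatible (P Q : mvfield) : Prop := schouten 2 P Q = 0.

Definition modular_vector (P : mvfield) (k : 'rV[R]_n) : Prop :=
  hat_vec k = D 2 P.

Definition decomposition (P : mvfield) (k : 'rV[R]_n) (L : mvfield) : Prop :=
  [/\ linear_bivector L, D 2 L = 0
    & P = (n%:R - 1)^-1 *: wedge (hat_mx 1%:M) (hat_vec k) + L].

End Multivectors.

(* Main.v *)
Require Import Defs.
From HB Require Import structures.
From mathcomp Require Import all_boot all_order all_algebra.
From mathcomp Require Import all_classical all_reals all_analysis.
Import Order.TTheory GRing.Theory Num.Theory numFieldNormedType.Exports.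
From mathcomp Require Import fintype finset ring.
Local Open Scope ring_scope.

Set Implicit Arguments.
Unset Strict Implicit.
Unset Printing Implicit Defensive.

(** The key is the coordinate form of D: on homogeneous multivector fields, D U
is the sum over j of i_j (d_j U), where d_j differentiates the coefficients and
i_j is contraction with dx_j ([D_homog]). Since d_j is a derivation and i_j a
graded derivation of the wedge product, expanding D (U /\ V) produces the four
families of terms of [U, V] = D (U /\ V) - D U /\ V - (-1)^i U /\ D V
([schouten_D]): the Schouten bracket is the defect of D to be a derivation.

Let E be the Euler field hat I, k a constant field, W = E /\ k and
c = 1 / (n - 1). In D W, contracting d_j E = d/dx_j with dx_j contributes n k
while contracting k contributes - k, so that D W = (n - 1) k
([D_euler_wedge]). Hence a decomposition P = c W + L with D L = 0 forces
k = D P and then L = P - c W; conversely these choices work, because D P is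
constant when P is linear.

The bracket [W, W] vanishes: the formula above expresses it by products in which
k occurs twice ([schouten_euler_wedge]). The bracket of bivector fields being
symmetric, 0 = [P, P] = c [W, P] + [L, P] = c [W, L] + [L, P], while
[L, P] = c [L, W] + [L, L]; therefore [L, P] = [L, L] / 2
([schouten_decomposition]). So compatibility with P comes for free once L is
Poisson, and D L = 0 gives [L, L] = D (L /\ L). In dimension 3 the 4-vector
field L /\ L is zero. *)

(** * Shuffle signs *)

Section ShuffleSign.
Variables (R : realType) (n : nat).
Implicit Types (I J K : {set 'I_n}) (j : 'I_n).
Local Notation sg := (@shuffle_sign R n).

(** As a product over pairs the sign is bimultiplicative for disjoint unions;
additivity in each block and the exchange rule are read off this form. *)
Lemma shuffle_signE I J :
  sg I J = \prod_(p in I) \prod_(q in J) (-1) ^+ (q < p)%N.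
Proof.
rewrite pair_big /= /shuffle_sign -sum1_card -prodrXr /=.
rewrite [RHS](bigID (fun p : 'I_n * 'I_n => (p.2 < p.1)%N)) /=.
rewrite [X in _ = _ * X]big1 ?mulr1 => [|p /andP[_ /negbTE -> //]].
by apply: eq_big => [p|p]; rewrite inE andbA // => /andP[_ ->].
Qed.

Lemma shuffle_sign_sqr I J : sg I J * sg I J = 1.
Proof. by rewrite -expr2 sqrr_sign. Qed.

Lemma shuffle_sign0l J : sg set0 J = 1.
Proof. by rewrite shuffle_signE big_set0. Qed.

Lemma shuffle_sign0r I : sg I set0 = 1.
Proof. by rewrite shuffle_signE big1 // => p _; rewrite big_set0. Qed.

Lemma shuffle_signUl I J K :
  [disjoint I & J] -> sg (I :|: J) K = sg I K * sg J K.
Proof.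
by move=> dIJ; rewrite !shuffle_signE -bigU //=; apply: eq_bigl => p; rewrite !inE.
Qed.

Lemma shuffle_signUr I J K :
  [disjoint J & K] -> sg I (J :|: K) = sg I J * sg I K.
Proof.
move=> dJK; rewrite !shuffle_signE -big_split /=; apply: eq_bigr => p _.
by rewrite -bigU //=; apply: eq_bigl => q; rewrite !inE.
Qed.

(** Each pair of I x J is an inversion for exactly one of the two orders. *)
Lemma shuffle_signC I J :
  [disjoint I & J] -> sg J I = (-1) ^+ (#|I| * #|J|) * sg I J.
Proof.
move=> dIJ; suff <- : sg J I * sg I J = (-1) ^+ (#|I| * #|J|).
  by rewrite -mulrA shuffle_sign_sqr mulr1.
rewrite !shuffle_signE exchange_big -big_split /= mulnC exprM -prodr_const.
apply: eq_bigr => p pI; rewrite -big_split /= -prodr_const.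
apply: eq_bigr => q qJ; have : q != p.
  by apply: contraL qJ => /eqP->; rewrite (disjointFr dIJ).
by rewrite -val_eqE /=; case: (ltngtP q p) => //= _; rewrite ?mulr1 ?mul1r.
Qed.

Lemma shuffle_signU1l j I K :
  j \notin I -> sg (j |: I) K = sg [set j] K * sg I K.
Proof. by move=> jI; rewrite shuffle_signUl // disjoints1. Qed.

Lemma shuffle_signU1r j I K :
  j \notin K -> sg I (j |: K) = sg I [set j] * sg I K.
Proof. by move=> jK; rewrite shuffle_signUr // disjoints1. Qed.

Lemma shuffle_sign1C j I :
  j \notin I -> sg I [set j] = (-1) ^+ #|I| * sg [set j] I.
Proof. by move=> jI; rewrite shuffle_signC ?disjoints1 // cards1 mul1n. Qed.
End ShuffleSign.


(** * The graded algebra of multivector fields *)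

Section Wedge.
Variables (R : realType) (n : nat).
Implicit Types (I J K : {set 'I_n}) (j : 'I_n) (U V W : mvfield R n).
Local Notation sg := (@shuffle_sign R n).
Local Notation interior := (@Defs.interior R n).

Definition homog (k : nat) U := forall I, #|I| != k -> U I = 0.

Lemma homogD k U V : homog k U -> homog k V -> homog k (U + V).
Proof.
by move=> hU hV I nI; apply/funext => x; rewrite /= !fctE hU ?hV //= addr0.
Qed.

Lemma homogZ k (c : R) U : homog k U -> homog k (c *: U).
Proof. by move=> hU I nI; apply/funext => x; rewrite !fctE hU //= scaler0. Qed.

Lemma wedge_combl (c : R) U V W :
  wedge (c *: U + V) W = c *: wedge U W + wedge V W.
Proof.
apply/funext => K; apply/funext => x.
rewrite !fctE /wedge scaler_sumr -big_split /=; apply: eq_bigr => I _.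
by rewrite !fctE /GRing.scale /=; ring.
Qed.

Lemma wedge_combr (c : R) U V W :
  wedge W (c *: U + V) = c *: wedge W U + wedge W V.
Proof.
apply/funext => K; apply/funext => x.
rewrite !fctE /wedge scaler_sumr -big_split /=; apply: eq_bigr => I _.
by rewrite !fctE /GRing.scale /=; ring.
Qed.

Lemma wedge0l W : wedge 0 W = 0.
Proof.
by apply/funext => K; apply/funext => x; apply: big1 => I _; rewrite mulr0 mul0r.
Qed.

Lemma wedge0r W : wedge W 0 = 0.
Proof.
by apply/funext => K; apply/funext => x; apply: big1 => I _; rewrite mulr0.
Qed.

Lemma wedge_suml (T : finType) (F : T -> mvfield R n) W :
  wedge (\sum_t F t) W = \sum_t wedge (F t) W.
Proof.
apply: (big_morph (fun U => wedge U W)) => [U V|]; last exact: wedge0l.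
by have := wedge_combl 1 U V W; rewrite !scale1r.
Qed.

Lemma wedge_sumr (T : finType) W (F : T -> mvfield R n) :
  wedge W (\sum_t F t) = \sum_t wedge W (F t).
Proof.
apply: (big_morph (wedge W)) => [U V|]; last exact: wedge0r.
by have := wedge_combr 1 U V W; rewrite !scale1r.
Qed.

Lemma interior_comb j (c : R) U V :
  interior j (c *: U + V) = c *: interior j U + interior j V.
Proof.
apply/funext => I; apply/funext => x; rewrite /interior !fctE.
by case: ifP => _; rewrite /GRing.scale /=; ring.
Qed.

Lemma homog_wedge i k U V : homog i U -> homog k V -> homog (i + k) (wedge U V).
Proof.
move=> hU hV K nK; apply/funext => x; apply: big1 => I sIK.
have [cI|/hU->] := eqVneq #|I| i; last by rewrite mulr0 mul0r.
rewrite (hV (K :\: I)) ?mulr0 //; apply: contra nK => /eqP <-.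
by rewrite cardsD (setIidPr sIK) -cI subnKC // subset_leq_card.
Qed.

Lemma homog_interior i j U : homog i.+1 U -> homog i (interior j U).
Proof.
move=> hU I nI; apply/funext => x; rewrite /interior.
by case: ifPn => // jI; rewrite hU ?mulr0 // cardsU1 jI.
Qed.

Lemma wedge_eq0_dim i U : homog i U -> (n < i)%N -> U = 0.
Proof.
move=> hU ni; apply/funext => K; rewrite hU // neq_ltn.
by rewrite (leq_ltn_trans _ ni) // -[X in (_ <= X)%N](card_ord n) max_card.
Qed.

(** Graded commutativity: complementation I |-> K \ I exchanges the two sums. *)
Lemma wedgeC i k U V : homog i U -> homog k V ->
  wedge U V = (-1) ^+ (i * k) *: wedge V U.
Proof.
move=> hU hV; apply/funext => K; apply/funext => x.
rewrite !fctE /wedge scaler_sumr.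
rewrite (reindex_onto (fun I => K :\: I) (fun I => K :\: I)) /=; last first.
  by move=> I sIK; rewrite setDDr setDv set0U; apply/setIidPr.
have e I : I \subset K -> K :\: (K :\: I) = I.
  by move=> sIK; rewrite setDDr setDv set0U; apply/setIidPr.
apply: eq_big => I.
  by rewrite subsetDl /=; apply/eqP/idP => [<-|/e//]; rewrite subsetDl.
case/andP=> _ /eqP ->; rewrite (@shuffle_signC _ _ I); last first.
  by rewrite disjoint_sym disjoints_subset setDE subsetIr.
have [cI|/hV->] := eqVneq #|I| k; last by rewrite !(mulr0,mul0r,scaler0).
have [cJ|/hU->] := eqVneq #|K :\: I| i; last by rewrite !(mulr0,mul0r,scaler0).
by rewrite cI cJ mulnC /GRing.scale /=; ring.
Qed.

(** Both sides are sums over the ordered partitions of K into three blocks; a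
summand of the right-hand side is indexed by I and by the union I u J of the
first two blocks. *)
Lemma wedgeA U V W : wedge U (wedge V W) = wedge (wedge U V) W.
Proof.
apply/funext => K; apply/funext => x; rewrite /wedge.
under eq_bigr do rewrite mulr_sumr.
under [RHS]eq_bigr do rewrite mulr_sumr mulr_suml.
rewrite [RHS](exchange_big_dep (fun I => I \subset K)) /=; last first.
  by move=> M I sM sI; rewrite (subset_trans sI).
apply: eq_bigr => I sIK.
have UD J : J \subset K :\: I -> (I :|: J) :\: I = J.
  rewrite subsetD disjoint_sym => /andP[_ /disjoint_setI0 dIJ].
  by rewrite setDUl setDv set0U; apply/setDidPl; rewrite -setI_eq0 setIC dIJ.
rewrite [RHS](reindex_onto (fun J => I :|: J) (fun M => M :\: I)) /=; last first.
  by move=> M /andP[_ sIM]; rewrite setDE setUIr setUCr setIT; apply/setUidPr.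
apply: eq_big => [J|J sJ].
  rewrite subUset subsetUl sIK /= andbT; apply/idP/andP => [sJ|[sJ /eqP <-]].
    by rewrite UD // (subset_trans sJ) ?subsetDl.
  by rewrite setSD // subUset sIK sJ.
rewrite UD // -setDDl.
have dIJ : [disjoint I & J].
  by move: sJ; rewrite subsetD disjoint_sym => /andP[].
set L := K :\: I; have dJ : [disjoint J & L :\: J].
  by rewrite disjoint_sym disjoints_subset setDE subsetIr.
rewrite (@shuffle_signUl _ _ I J) // -{1}(setID L J) (setIidPr sJ).
by rewrite shuffle_signUr //; ring.
Qed.
(** Splits the subsets of j |: K according to whether they contain j; in
[interior_wedge] this turns every sum into one over subsets avoiding j. *)
Lemma big_subsetU1 j K (F : {set 'I_n} -> R) : j \notin K ->
  \sum_(I : {set 'I_n} | I \subset j |: K) F I =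
  \sum_(I : {set 'I_n} | I \subset K) (F I + F (j |: I)).
Proof.
move=> jK; rewrite (bigID (fun I => j \in I)) /= addrC big_split /=; congr (_ + _).
  apply: eq_bigl => I; apply/andP/idP => [[sI jI]|sI].
    by rewrite -(setU1K jK) subsetD1 sI.
  split; first by rewrite (subset_trans sI) // subsetUr.
  by apply: contra jK => /(subsetP sI).
rewrite (reindex_onto (fun I => j |: I) (fun I => I :\ j)) /=; last first.
  by move=> I /andP[_ jI]; rewrite setD1K.
apply: eq_bigl => I; rewrite setU11 andbT; apply/andP/idP.
  by case=> sI /eqP <-; rewrite -(setU1K jK) setSD.
move=> sI; split; first exact: setUS.
by rewrite setU1K //; apply: contra jK => /(subsetP sI).
Qed.

(** Contraction with dx_j is a graded derivation. On a component K that contains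
j the left-hand side is zero, and on the right the terms of I and of j |: I
cancel; otherwise they match the two ways of adding j to a block of K. *)
Lemma interior_wedge i j U V : homog i U ->
  interior j (wedge U V) =
  wedge (interior j U) V + (-1) ^+ i *: wedge U (interior j V).
Proof.
move=> hU; apply/funext => K; apply/funext => x; rewrite !fctE /wedge.
rewrite scaler_sumr -big_split /= {1}/interior.
have signU I : (-1) ^+ #|I| * U I x = (-1) ^+ i * U I x.
  by have [->//|/hU ->] := eqVneq #|I| i; rewrite !mulr0.
case: ifPn => jK.
  rewrite -(setD1K jK) big_subsetU1 ?setD11 // big1 // => I sI.
  have jI : j \notin I by apply/negP => /(subsetP sI); rewrite setD11.
  have jM : j \notin K :\ j :\: I by rewrite !inE eqxx andbF.
  rewrite /interior setU11 (negbTE jI).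
  have -> : (j |: K :\ j) :\: I = j |: (K :\ j :\: I).
    by rewrite setDUl; congr (_ :|: _); apply/setDidPl; rewrite disjoints1.
  have -> : (j |: K :\ j) :\: (j |: I) = K :\ j :\: I.
    by apply/setP => q; rewrite !inE; case: (q == j); case: (q \in I).
  rewrite setU11 (negbTE jM).
  rewrite shuffle_signU1r // shuffle_sign1C // shuffle_signU1l //.
  have := signU (j |: I); rewrite cardsU1 jI exprS mulN1r => e.
  rewrite /GRing.scale /= !(mulr0, mul0r, addr0, add0r).
  set a := sg [set j] I; set b := sg [set j] _; set c := sg I _.
  set v := V _ x; set u := U _ x in e *.
  (* The squares of signs are isolated so that they can be replaced by 1. *)
  transitivity (a * a * ((-1) ^+ #|I| * u * c * v)
                + b * b * (((-1) ^+ i * u) * c * v)); first by ring.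
  by rewrite !shuffle_sign_sqr -e; ring.
rewrite big_subsetU1 // mulr_sumr; apply: eq_bigr => I sI.
have jI : j \notin I by apply: contra jK => /(subsetP sI).
have jM : j \notin K :\: I by rewrite !inE (negbTE jK) andbF.
rewrite /interior (negbTE jI) (negbTE jM).
have -> : (j |: K) :\: I = j |: (K :\: I).
  by rewrite setDUl; congr (_ :|: _); apply/setDidPl; rewrite disjoints1.
have -> : (j |: K) :\: (j |: I) = K :\: I.
  apply/setP => q; rewrite !inE; case: eqP => [->|//].
  by rewrite (negbTE jK) andbF.
have -> : sg [set j] K = sg [set j] I * sg [set j] (K :\: I).
  rewrite -{1}(setID K I) (setIidPr sI) shuffle_signUr //.
  by rewrite disjoint_sym disjoints_subset setDE subsetIr.
rewrite shuffle_signU1r // shuffle_sign1C // shuffle_signU1l //.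
have := signU I; rewrite /GRing.scale /=.
set a := sg [set j] I; set b := sg [set j] _; set c := sg I _.
set v := V _ x; set u := U I x; set w := V _ x; set z := U _ x => e.
transitivity (a * a * ((-1) ^+ #|I| * u * c * v * b)
              + b * b * (a * c * z * w)); first by ring.
by rewrite !shuffle_sign_sqr e; ring.
Qed.
End Wedge.

(** * The operator D and the Schouten bracket *)

Section Calculus.
Variables (R : realType) (n : nat).
Implicit Types (I J K : {set 'I_n}) (j : 'I_n) (U V W : mvfield R n).
Implicit Types (f : fctn R n).
Local Notation sg := (@shuffle_sign R n).
Local Notation interior := (@Defs.interior R n).

(** Differentiability is all that the first-order identities below need, and,
unlike smoothness, it passes to wedge products at once. *)
Definition diff_coef U := forall I x, differentiable (U I) x.

Lemma is_derive_bigsum (T : finType) (Q : pred T) (h : T -> fctn R n)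
    (dh : T -> R) (x v : 'rV[R]_n) :
  (forall t, Q t -> is_derive x v (h t) (dh t)) ->
  is_derive x v (fun y => \sum_(t | Q t) h t y) (\sum_(t | Q t) dh t).
Proof.
move=> dQ; rewrite -[f in is_derive _ _ f]fct_sumE.
by elim/big_rec2: _ => [|t df f /dQ]; [exact: is_derive_cst|exact: is_deriveD].
Qed.

Lemma is_derive_pderiv j f x : differentiable f x ->
  is_derive x (delta_mx 0 j : 'rV[R]_n) f (pderiv j f x).
Proof. by move=> df; apply: DeriveDef => //; apply: diff_derivable. Qed.

Lemma pderivE j f (df : R) x : is_derive x (delta_mx 0 j : 'rV[R]_n) f df ->
  pderiv j f x = df.
Proof. by move=> fd; apply: derive_val. Qed.

Lemma pderivZ j (c : R) f x : differentiable f x ->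
  pderiv j (fun y => c * f y) x = c * pderiv j f x.
Proof.
move=> df; apply: pderivE.
by apply: (@is_deriveZ _ _ _ f); apply: is_derive_pderiv.
Qed.

Lemma mpderiv_comb j (c : R) U V : diff_coef U -> diff_coef V ->
  mpderiv j (c *: U + V) = c *: mpderiv j U + mpderiv j V.
Proof.
move=> dU dV; apply/funext => I; apply/funext => x; apply: pderivE.
apply: is_deriveD; first apply: is_deriveZ; exact: is_derive_pderiv.
Qed.

Lemma mpderiv_wedge j U V : diff_coef U -> diff_coef V ->
  mpderiv j (wedge U V) = wedge (mpderiv j U) V + wedge U (mpderiv j V).
Proof.
move=> dU dV; apply/funext => K; apply/funext => x; apply: pderivE.
rewrite !fctE -big_split /=; apply: is_derive_bigsum => I _.
have dsU := is_deriveZ (sg I (K :\: I)) (is_derive_pderiv j (dU I x)).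
have dV' := is_derive_pderiv j (dV (K :\: I) x).
apply: is_derive_eq (is_deriveM dsU dV') _.
by rewrite /= /GRing.scale /= /mpderiv; ring.
Qed.

Lemma mpderiv0 j : mpderiv j (0 : mvfield R n) = 0.
Proof.
by apply/funext => I; apply/funext => x; apply: pderivE; exact: is_derive_cst.
Qed.

Lemma homog_mpderiv k j U : homog k U -> homog k (mpderiv j U).
Proof.
by move=> hU I nI; rewrite /mpderiv hU //; have := congr1 (@^~ I) (mpderiv0 j).
Qed.

Lemma diff_coef_comb (c : R) U V :
  diff_coef U -> diff_coef V -> diff_coef (c *: U + V).
Proof. by move=> dU dV I x; apply: differentiableD => //; apply: differentiableZ. Qed.

Lemma diff_coef_wedge U V : diff_coef U -> diff_coef V -> diff_coef (wedge U V).
Proof.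
move=> dU dV K x.
have -> : wedge U V K = \sum_(I : {set 'I_n} | I \subset K)
    (fun y => sg I (K :\: I) * U I y * V (K :\: I) y).
  by rewrite fct_sumE.
elim/big_ind: _ => [|f g|I _]; [exact: differentiable_cst|exact: differentiableD|].
apply: (@differentiableM _ _ (fun y => _ * U I y)) => //.
exact: (@differentiableZ _ _ _ (U I)).
Qed.

Lemma ext_dE (w : dform R n) K x :
  ext_d w K x = \sum_(j in K) sg [set j] (K :\ j) * pderiv j (w (K :\ j)) x.
Proof.
rewrite /ext_d !fct_sumE [RHS]big_mkcond; apply: eq_bigr => j _; rewrite /wedge.
case: ifPn => jK; last first.
  apply: big1 => J sJ; case: eqP => [eJ|_]; last by rewrite mulr0 mul0r.
  by move: sJ; rewrite eJ sub1set (negbTE jK).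
rewrite (bigD1 [set j]) ?sub1set //= eqxx mulr1 big1 ?addr0 // => J /andP[_ nJ].
by rewrite (negbTE nJ) mulr0 mul0r.
Qed.

(** The conjugation by Phi only contributes signs. Writing M for the complement
of j |: I, the factors sg {j} M and sg I M occur twice and cancel; what is left
is sg I {j} = (-1)^|I| sg {j} I, and (-1)^|I| is absorbed by the sign (-1)^(k+1)
in front of D when |I| = k - 1; in the other components both sides vanish. *)
Lemma D_homog k U : homog k U -> diff_coef U ->
  D k U = \sum_j interior j (mpderiv j U).
Proof.
move=> hU dU; apply/funext => I; apply/funext => x.
rewrite /D !fctE /Phi_inv ext_dE !fct_sumE mulr_sumr scaler_sumr big_mkcond /=.
apply: eq_bigr => j _; rewrite inE /interior; case: (boolP (j \in I)) => //= jI.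
have -> : Phi U (~: I :\ j) =
    fun y => sg (j |: I) (~: I :\ j) * U (j |: I) y.
  apply/funext => y; rewrite PhiE; suff -> : ~: (~: I :\ j) = j |: I by [].
  by rewrite setCD setCK setUC.
rewrite pderivZ //.
have jM : j \notin ~: I :\ j by rewrite setD11.
have {1}-> : ~: I = j |: (~: I :\ j) by rewrite setD1K // inE.
rewrite shuffle_signU1r // shuffle_sign1C // shuffle_signU1l // /mpderiv.
have [ck|/(homog_mpderiv j hU) z] := eqVneq #|j |: I| k; last first.
  have -> : pderiv j (U (j |: I)) x = 0 by have := congr1 (@^~ x) z.
  by rewrite !mulr0 scaler0.
rewrite -ck cardsU1 jI add1n !exprS /GRing.scale /=.
set a := sg [set j] I; set b := sg [set j] _; set c := sg I _.
set s := (-1) ^+ _; set p := pderiv _ _ _.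
transitivity (s ^+ 2 * (c * c) * (b * b) * (a * p)); first by ring.
by rewrite !shuffle_sign_sqr sqrr_sign; ring.
Qed.

Lemma D0 k : D k (0 : mvfield R n) = 0.
Proof.
have d0 : diff_coef (0 : mvfield R n) by move=> I x; exact: differentiable_cst.
rewrite (D_homog _ d0) //.
rewrite big1 // => j _; rewrite mpderiv0; apply/funext => I; apply/funext => x.
by rewrite /interior; case: ifP => // _; rewrite mulr0.
Qed.

Lemma D_comb k (c : R) U V : homog k U -> homog k V -> diff_coef U -> diff_coef V ->
  D k (c *: U + V) = c *: D k U + D k V.
Proof.
move=> hU hV dU dV.
rewrite (D_homog (homogD (homogZ c hU) hV) (diff_coef_comb c dU dV)).
rewrite (D_homog hU dU) (D_homog hV dV).
rewrite scaler_sumr -big_split /=; apply: eq_bigr => j _.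
by rewrite mpderiv_comb // interior_comb.
Qed.

(** The expansion of i_j (d_j (U /\ V)) by the two Leibniz rules has four terms.
Two of them sum to D U /\ V and (-1)^i U /\ D V, the other two are those of the
bracket. *)
Lemma schouten_D i k U V :
  homog i U -> homog k V -> diff_coef U -> diff_coef V ->
  schouten i U V =
  D (i + k) (wedge U V) - wedge (D i U) V - (-1) ^+ i *: wedge U (D k V).
Proof.
move=> hU hV dU dV.
rewrite (D_homog (homog_wedge hU hV) (diff_coef_wedge dU dV)).
rewrite (D_homog hU dU) (D_homog hV dV).
rewrite wedge_suml wedge_sumr scaler_sumr -!sumrB /schouten.
apply: eq_bigr => j _; rewrite mpderiv_wedge //.
have := interior_comb j 1 (wedge (mpderiv j U) V) (wedge U (mpderiv j V)).
rewrite !scale1r => ->; rewrite !(@interior_wedge _ _ i) //; last exact: homog_mpderiv.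
by apply/funext => K; apply/funext => x; rewrite !fctE /GRing.scale /=; ring.
Qed.

Lemma wedgeC21 U V : homog 2 U -> homog 1 V -> wedge U V = wedge V U.
Proof. by move=> hU hV; rewrite (wedgeC hU hV) -signr_odd expr0 scale1r. Qed.

(** The two terms of the bracket are exchanged, as fields of degree 1 and 2
commute. *)
Lemma schouten_bivectorC U V : homog 2 U -> homog 2 V ->
  schouten 2 U V = schouten 2 V U.
Proof.
move=> hU hV; apply: eq_bigr => j _; rewrite -signr_odd expr0 !scale1r addrC.
congr (_ + _).
  by apply: wedgeC21; [exact: homog_mpderiv|exact: homog_interior].
by apply/esym/wedgeC21; [exact: homog_mpderiv|exact: homog_interior].
Qed.

Lemma schouten_combr i (c : R) U V W : diff_coef U -> diff_coef V ->
  schouten i W (c *: U + V) = c *: schouten i W U + schouten i W V.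
Proof.
move=> dU dV; rewrite scaler_sumr -big_split /=; apply: eq_bigr => j _.
rewrite mpderiv_comb // interior_comb !wedge_combr.
by apply/funext => K; apply/funext => x; rewrite !fctE /GRing.scale /=; ring.
Qed.
End Calculus.

(** * Linear coefficients and the Euler field *)

Section Linear.
Variables (R : realType) (n : nat).
Implicit Types (I J K : {set 'I_n}) (j : 'I_n) (U V W : mvfield R n).
Implicit Types (f : fctn R n) (k : 'rV[R]_n).
Local Notation interior := (@Defs.interior R n).

Lemma scalar_coord f : scalar f ->
  f = fun x => \sum_(j < n) f (delta_mx 0 j) * x 0 j.
Proof.
move=> lf; pose F := HB.pack_for {linear 'rV[R]_n -> R} f
  (GRing.isLinear.Build R 'rV[R]_n R *%R f lf).
apply/funext => x; have -> : f = F by [].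
rewrite [in LHS](row_sum_delta x) linear_sum; apply: eq_bigr => j _.
by rewrite linearZ /= mulrC.
Qed.

Lemma scalar_differentiable f x : scalar f -> differentiable f x.
Proof.
move=> /scalar_coord ->.
pose g j : fctn R n := fun y => f (delta_mx 0 j) * y 0 j.
have -> : (fun y : 'rV[R]_n => \sum_(j < n) f (delta_mx 0 j) * y 0 j) = \sum_(j < n) g j.
  by rewrite fct_sumE.
apply: differentiable_sum => j.
apply: (@differentiableZ _ _ _ (fun y : 'rV[R]_n => y 0 j : R)).
exact: differentiable_coord.
Qed.

Lemma pderiv_scalar j f : scalar f -> pderiv j f = fun=> f (delta_mx 0 j).
Proof.
move=> lf; pose F := HB.pack_for {linear 'rV[R]_n -> R} f
  (GRing.isLinear.Build R 'rV[R]_n R *%R f lf).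
apply/funext => x; rewrite /pderiv deriveE; last exact: scalar_differentiable.
have -> : f = F by [].
rewrite diff_lin // => y; apply: differentiable_continuous.
exact: scalar_differentiable.
Qed.

(** Iterated derivatives of a linear form are the form itself or constants. *)
Lemma scalar_smooth f : scalar f -> smooth f.
Proof.
move=> lf s x.
suff [->|[c ->]] : foldr (@pderiv R n) f s = f \/
    exists c, foldr (@pderiv R n) f s = fun=> c.
- exact: scalar_differentiable.
- exact: differentiable_cst.
elim: s => [|j s IHs] /=; first by left.
right; case: IHs => [->|[c ->]]; first by exists (f (delta_mx 0 j)); exact: pderiv_scalar.
by exists 0; apply/funext => y; apply: pderivE; exact: is_derive_cst.
Qed.

Lemma linear_bivector_homog U : homog 2 U -> linear_coef U -> linear_bivector U.
Proof. by move=> hU lU; split=> //; split=> // I; apply: scalar_smooth. Qed.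

Lemma linear_diff_coef U : linear_coef U -> diff_coef U.
Proof. by move=> lU I x; apply: scalar_differentiable. Qed.

Lemma linear_coef_comb (c : R) U V :
  linear_coef U -> linear_coef V -> linear_coef (c *: U + V).
Proof.
move=> lU lV I a x y; rewrite !fctE lU lV /GRing.scale /=; ring.
Qed.

Lemma mpderiv_linear_coef j U : linear_coef U ->
  mpderiv j U = fun I _ => U I (delta_mx 0 j).
Proof. by move=> lU; apply/funext => I; apply: pderiv_scalar. Qed.

Lemma homog_vfield (X : 'I_n -> fctn R n) : homog 1 (vfield X).
Proof.
move=> I nI; apply/funext => x; apply: big1 => i /eqP eI.
by rewrite eI cards1 in nI.
Qed.

Lemma vfield1 (X : 'I_n -> fctn R n) i x : vfield X [set i] x = X i x.
Proof. by rewrite /vfield (big_pred1 i) // => j; rewrite (inj_eq set1_inj) eq_sym. Qed.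

Lemma hat_vec1 k i x : hat_vec k [set i] x = k 0 i.
Proof. exact: vfield1. Qed.

Lemma hat_mx1 (A : 'M[R]_n) i x : hat_mx A [set i] x = \sum_(j < n) A i j * x 0 j.
Proof. exact: vfield1. Qed.

Lemma homog1_ext U V : homog 1 U -> homog 1 V ->
  (forall i x, U [set i] x = V [set i] x) -> U = V.
Proof.
move=> hU hV e; apply/funext => I; apply/funext => x.
by have [/eqP/cards1P[i ->]|nI] := eqVneq #|I| 1%N; [|rewrite hU ?hV].
Qed.

Lemma hat_vec_inj : injective (@hat_vec R n).
Proof.
move=> k k' e; apply/rowP => i; have := congr1 (fun U : mvfield R n => U [set i] 0) e.
by rewrite /= !hat_vec1.
Qed.

Lemma linear_hat_mx A : linear_coef (@hat_mx R n A).
Proof.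
move=> I c x y; rewrite /hat_mx /vfield mulr_sumr -big_split /=.
apply: eq_bigr => i _; rewrite mulr_sumr -big_split /=.
by apply: eq_bigr => j _; rewrite !mxE; ring.
Qed.

Lemma diff_hat_vec k : diff_coef (hat_vec k).
Proof. by move=> I x; exact: differentiable_cst. Qed.

Lemma mpderiv_hat_vec j k : mpderiv j (hat_vec k) = 0.
Proof.
by apply/funext => I; apply/funext => x; apply: pderivE; exact: is_derive_cst.
Qed.

Lemma mpderiv_euler j : mpderiv j (hat_mx 1%:M) = hat_vec (delta_mx 0 j : 'rV[R]_n).
Proof.
rewrite mpderiv_linear_coef; last exact: linear_hat_mx.
apply: homog1_ext => [I nI||i x]; [|exact: homog_vfield|].
  by apply/funext => x; rewrite /hat_mx homog_vfield.
rewrite hat_mx1 hat_vec1 (bigD1 i) //= big1 => [|l li]; rewrite !mxE.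
  by rewrite eqxx mul1r addr0.
by rewrite eq_sym (negbTE li) mul0r.
Qed.

(** The constant function c as a 0-vector field: the contraction of a constant
vector field with dx_j is of this kind. *)
Definition zerovector (c : R) : mvfield R n := fun I _ => (I == set0)%:R * c.

Lemma interior_hat_vec j k : interior j (hat_vec k) = zerovector (k 0 j).
Proof.
apply/funext => I; apply/funext => x; rewrite /interior /zerovector.
have [->|nI] := eqVneq I set0; first by rewrite inE setU0 hat_vec1 shuffle_sign0r.
rewrite mul0r; case: ifPn => // jI; rewrite /hat_vec homog_vfield ?mulr0 //.
by rewrite cardsU1 jI eqSS cards_eq0.
Qed.

Lemma wedge_zerovectorl c V : wedge (zerovector c) V = c *: V.
Proof.
apply/funext => K; apply/funext => x; rewrite /wedge (bigD1 set0) ?sub0set //=.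
rewrite /zerovector eqxx shuffle_sign0l setD0 big1 ?addr0 ?mul1r // => I /andP[_ /negbTE ->].
by rewrite mul0r mulr0 mul0r.
Qed.

Lemma wedge_zerovectorr c V : wedge V (zerovector c) = c *: V.
Proof.
apply/funext => K; apply/funext => x; rewrite /wedge (bigD1 K) //=.
rewrite /zerovector setDv eqxx shuffle_sign0r big1 ?addr0 => [|I /andP[sI nI]].
  by rewrite !mul1r mulrC.
case: eqP => [e|_]; last by rewrite mul0r mulr0.
case/eqP: nI; apply/eqP; rewrite eqEsubset sI -setD_eq0; exact/eqP.
Qed.

Local Notation euler_wedge k := (wedge (hat_mx 1%:M) (hat_vec k)).

Lemma homog_euler_wedge k : homog 2 (euler_wedge k).
Proof. by apply: (@homog_wedge _ _ 1 1); apply: homog_vfield. Qed.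

Lemma linear_euler_wedge k : linear_coef (euler_wedge k).
Proof.
move=> K c x y; rewrite /wedge mulr_sumr -big_split; apply: eq_bigr => I _ /=.
rewrite linear_hat_mx /hat_vec /vfield; ring.
Qed.

(** Since d_j E = d/dx_j and d_j k = 0, the j-th term of D (E /\ k) is
i_j (d/dx_j /\ k) = k - k_j d/dx_j; the sum over j is n k - k. *)
Lemma D_euler_wedge k : D 2 (euler_wedge k) = (n%:R - 1) *: hat_vec k.
Proof.
have lE := linear_diff_coef (linear_hat_mx 1%:M).
rewrite (D_homog (@homog_euler_wedge k) (linear_diff_coef (@linear_euler_wedge k))).
under eq_bigr => j _.
  rewrite mpderiv_wedge //; last exact: diff_hat_vec.
  rewrite mpderiv_hat_vec wedge0r addr0 mpderiv_euler.
  rewrite (@interior_wedge _ _ 1); last exact: homog_vfield.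
  rewrite !interior_hat_vec wedge_zerovectorl wedge_zerovectorr mxE !eqxx /= scale1r.
  over.
apply: homog1_ext => [||i x].
- by move=> I nI; rewrite fct_sumE big1 // => j _; apply/funext => x;
    rewrite !fctE /hat_vec !homog_vfield //= !scaler0 addr0.
- by apply: homogZ; exact: homog_vfield.
rewrite !fct_sumE !fctE hat_vec1.
under eq_bigr do rewrite !fctE !hat_vec1 mxE eqxx /=.
rewrite big_split /= sumr_const card_ord (bigD1 i) //= big1 => [|j ji].
  by rewrite eqxx /GRing.scale /= -mulr_natr; ring.
by rewrite eq_sym (negbTE ji) /GRing.scale /= !mulr0.
Qed.

Lemma wedge_vector_sqr0 U : homog 1 U -> wedge U U = 0.
Proof.
move=> hU; have := wedgeC hU hU; rewrite expr1 scaleN1r => e.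
apply/funext => K; apply/funext => x.
by apply/eqP; rewrite -eqNr {2}e.
Qed.

(** In [W, W] = D (W /\ W) - D W /\ W - W /\ D W with D W = (n - 1) k, every
product contains k /\ k up to reordering. *)
Lemma schouten_euler_wedge k : schouten 2 (euler_wedge k) (euler_wedge k) = 0.
Proof.
have hE : homog 1 (hat_mx (1%:M : 'M[R]_n)) by exact: homog_vfield.
have hk : homog 1 (hat_vec k) by exact: homog_vfield.
have hW := @homog_euler_wedge k.
have dW := linear_diff_coef (@linear_euler_wedge k).
have Wk : wedge (euler_wedge k) (hat_vec k) = 0.
  by rewrite -wedgeA wedge_vector_sqr0 // wedge0r.
have kW : wedge (hat_vec k) (euler_wedge k) = 0.
  by rewrite (wedgeC hk hW) Wk scaler0.
rewrite (schouten_D hW hW) // D_euler_wedge -wedgeA kW wedge0r D0.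
rewrite -[_ *: hat_vec k]addr0 wedge_combl wedge_combr kW Wk wedge0l wedge0r.
by rewrite !(scaler0, addr0, subr0).
Qed.
End Linear.

(** * The decomposition *)

Section Decomposition.
Variables (R : realType) (n : nat).
Implicit Types (P L : mvfield R n) (k : 'rV[R]_n).
Local Notation euler_wedge k := (wedge (hat_mx 1%:M) (hat_vec k)).

(** The field D P is constant, so its components may be read off at the origin. *)
Lemma exists_modular_vector P : homog 2 P -> linear_coef P ->
  exists k, modular_vector P k.
Proof.
move=> hP lP; exists (\row_i D 2 P [set i] 0).
rewrite /modular_vector (D_homog hP (linear_diff_coef lP)).
apply: homog1_ext => [||i x].
- exact: homog_vfield.
- move=> I nI; rewrite fct_sumE big1 // => j _.
  by rewrite (@homog_interior _ _ 1) //; exact: homog_mpderiv.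
rewrite hat_vec1 mxE !fct_sumE; apply: eq_bigr => j _.
by rewrite /Defs.interior !mpderiv_linear_coef.
Qed.

(** Applying D to the decomposition leaves c D (E /\ k) = k; this is where
n - 1 must be nonzero. *)
Lemma decomposition_modular (hn : (2 <= n)%N) P k L :
  decomposition P k L -> modular_vector P k.
Proof.
case=> [[[hL sL] lL] DL ->]; rewrite /modular_vector.
have dW := linear_diff_coef (@linear_euler_wedge R n k).
rewrite (D_comb _ (@homog_euler_wedge R n k) hL dW (linear_diff_coef lL)).
rewrite D_euler_wedge DL addr0 scalerA mulVf ?scale1r //.
by rewrite subr_eq0 pnatr_eq1 gtn_eqF.
Qed.

Lemma decomposition_unique (hn : (2 <= n)%N) P k L k' L' :
  decomposition P k L -> decomposition P k' L' -> k' = k /\ L' = L.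
Proof.
move=> dP dP'.
have kk : k' = k.
  apply: hat_vec_inj.
  by rewrite (decomposition_modular hn dP) (decomposition_modular hn dP').
split=> //; case: dP dP' => [_ _ eP] [_ _ eP'].
by apply: (@addrI _ ((n%:R - 1)^-1 *: euler_wedge k)); rewrite -eP -kk -eP'.
Qed.

Lemma schouten_divergence_free L : homog 2 L -> diff_coef L -> D 2 L = 0 ->
  schouten 2 L L = D 4 (wedge L L).
Proof.
move=> hL dL DL; rewrite (schouten_D hL hL dL dL) DL wedge0l wedge0r.
by rewrite scaler0 !subr0.
Qed.

(** With W = E /\ k, expanding [P, P] = 0 and [L, P] along P = c W + L gives
c [L, W] + [L, P] = 0 and [L, P] = c [L, W] + [L, L]; eliminating [L, W] yields
2 [L, P] = [L, L]. *)
Lemma schouten_decomposition P k L : linear_poisson P -> decomposition P k L ->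
  schouten 2 L P = 2^-1 *: schouten 2 L L.
Proof.
move=> [[[hP _] PP] _] [[[hL _] lL] _ eP].
have dL := linear_diff_coef lL.
have hW := @homog_euler_wedge R n k.
have dW := linear_diff_coef (@linear_euler_wedge R n k).
set c := (n%:R - 1)^-1 in eP; set W := wedge _ _ in eP hW dW.
have LP : schouten 2 L P = c *: schouten 2 L W + schouten 2 L L.
  by rewrite eP schouten_combr.
have WP : schouten 2 W P = schouten 2 L W.
  by rewrite eP schouten_combr // schouten_euler_wedge scaler0 add0r schouten_bivectorC.
have PP' : c *: schouten 2 L W + schouten 2 L P = 0.
  (* [P, P] is expanded in its second argument only. *)
  rewrite -WP -(schouten_bivectorC hP hW) -(schouten_bivectorC hP hL).
  rewrite -schouten_combr // -eP.
  exact: PP.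
have -> : schouten 2 L L = 2 *: schouten 2 L P.
  move/eqP: PP'; rewrite addr_eq0 => /eqP cW.
  by rewrite scaler_nat mulr2n {2}LP cW addNKr.
by rewrite scalerA mulVf ?scale1r // pnatr_eq0.
Qed.
End Decomposition.

Theorem theorem2p1 (R : realType) (n : nat) (hn : (2 <= n)%N)
    (P : mvfield R n) (hP : linear_poisson P) :
  exists (k : 'rV[R]_n) (L : mvfield R n),
    [/\ modular_vector P k,
        decomposition P k L,
        (forall (k' : 'rV[R]_n) (L' : mvfield R n),
           decomposition P k' L' -> k' = k /\ L' = L),
        (poisson L /\ compatible L P) <-> D 4 (wedge L L) = 0
      & n = 3%N -> linear_poisson L /\ unimodular L].
Proof.
have [[[hP2 sP] PP] lP] := hP.
have [k kP] := exists_modular_vector hP2 lP.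
pose c : R := (n%:R - 1)^-1.
pose W : mvfield R n := wedge (hat_mx 1%:M) (hat_vec k).
have hW : homog 2 W by exact: homog_euler_wedge.
have lW : linear_coef W by exact: linear_euler_wedge.
pose L := - c *: W + P.
have hL : homog 2 L by exact: homogD (homogZ _ hW) hP2.
have lL : linear_coef L by exact: linear_coef_comb.
have DL : D 2 L = 0.
  rewrite (D_comb _ hW hP2 (linear_diff_coef lW) (linear_diff_coef lP)) D_euler_wedge.
  rewrite -kP scalerA mulNr mulVf ?scaleN1r ?addNr //.
  by rewrite subr_eq0 pnatr_eq1 gtn_eqF.
have dPL : decomposition P k L.
  by split=> //; [exact: linear_bivector_homog|rewrite /L scaleNr addNKr].
have kL : kvector 2 L by case: (linear_bivector_homog hL lL).
have LL := schouten_divergence_free hL (linear_diff_coef lL) DL.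
exists k, L; split=> //.
- by move=> k' L'; apply: decomposition_unique.
- rewrite -LL; split=> [[[]]//|L0]; split; first by split.
  by rewrite /compatible (schouten_decomposition hP dPL) L0 scaler0.
- move=> n3; split=> //; split=> //; split=> //.
  rewrite LL (@wedge_eq0_dim _ _ 4 (wedge L L)) ?D0 ?n3 //.
  exact: (homog_wedge hL hL).
Qed.
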